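(* Assume that for every $q>0$: (B1-$q$) $\displaystyle\sup_{n\ge1}\max_{l\in\{1,2\}}\sup_{0\le t\le(n-1)h_n}E[(\mathcal N^{n,l}_{t+h_n}-\mathcal N^{n,l}_t)^q]<\infty$; (B2-$q$) $\displaystyle\limsup_{u\to\infty}\sup_{n\ge1}\max_{l\in\{1,2\}}\sup_{0\le t\le nh_n-uh_n}u^qP(\mathcal N^{n,l}_{t+uh_n}-\mathcal N^{n,l}_t=0)<\infty$; and $\displaystyle\sup_{n\in\mathbb N}\sum_{k=0}^\infty(k+1)^q\alpha_k^n<\infty$. Moreover, assume that there exist nonnegative constants $f_p^{1,1},f_p^{1,2},f_p^{2,2}$ for $p\in\mathbb Z_+$ such that $$\max_{1\le k\le q_n}|E[\mathfrak I_1^\top\mathcal E^1_{(k)}(GG^\top)^p\mathfrak I_1]-f_p^{1,1}(s_k-s_{k-1})|\to0,$$ $$\max_{1\le k\le q_n}|E[\mathfrak I_1^\top\mathcal E^1_{(k)}(GG^\top)^pG\mathfrak I_2]-f_p^{1,2}(s_k-s_{k-1})|\to0,$$ $$\max_{1\le k\le q_n}|E[\mathfrak I_2^\top\mathcal E^2_{(k)}(G^\top G)^p\mathfrak I_2]-f_p^{2,2}(s_k-s_{k-1})|\to0$$ as $n\to\infty$ for all $p\in\mathbb Z_+$ and any partition $(s_k)_{k=0}^\infty\in\mathfrak S$. Then for each $p\in\mathbb Z_+$ there exist nonnegative constants $f_p^{1,1},f_p^{1,2},f_p^{2,2}$ such that, for any $(s_k)\in\mathfrak S$, as $n\to\infty$,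 $$\max_{1\le k\le q_n}|\mathfrak I_1^\top\mathcal E^1_{(k)}(GG^\top)^p\mathfrak I_1-f_p^{1,1}(s_k-s_{k-1})|\to0,\quad \max_{1\le k\le q_n}|\mathfrak I_1^\top\mathcal E^1_{(k)}(GG^\top)^pG\mathfrak I_2-f_p^{1,2}(s_k-s_{k-1})|\to0,$$ $$\max_{1\le k\le q_n}|\mathfrak I_2^\top\mathcal E^2_{(k)}(G^\top G)^p\mathfrak I_2-f_p^{2,2}(s_k-s_{k-1})|\to0$$ in probability.
   Context: $(h_n)_{n\ge1}$ are positive numbers with $h_n\to0$, $T_n:=nh_n\to\infty$, $nh_n^2\to0$. For each $n$ and $l\in\{1,2\}$, $0=S^{n,l}_0<S^{n,l}_1<\dots<S^{n,l}_{M_l}=T_n$ are random times ($M_l$ a random positive integer depending on $n$). $I_i^l=(S^{n,l}_{i-1},S_i^{n,l}]$, $|\cdot|$ is interval length, $\mathfrak I_l=(|I_i^l|^{1/2})_{i=1}^{M_l}$ (column vector). $G$ is the $M_1\times M_2$ matrix $[G]_{ij}=|I_i^1\cap I_j^2|/(|I_i^1|^{1/2}|I_j^2|^{1/2})$. $\mathfrak S$ is the set of partitions $0=s_0<s_1<\cdots$ of $[0,\infty)$ with $\sup_{k\ge1}|s_k-s_{k-1}|\le1$ and $\inf_{k\ge1}|s_k-s_{k-1}|>0$. For $(s_k)\in\mathfrak S$: $q_n=\max\{k:s_k\le nh_n\}$ and $\mathcal E^l_{(k)}$ is the $M_l\times M_l$ diagonal matrix with $i$th diagonal entry $1$ if $\sup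 I_i^l\in(s_{k-1},s_k]$ and $0$ otherwise. $\mathcal N^{n,l}_t=\sum_{i=1}^{M_l}1_{\{S_i^{n,l}\le t\}}$. Mixing coefficients: $\mathcal G^n_{i,j}=\sigma(\mathcal N^{n,l}_t-\mathcal N^{n,l}_s;\ ih_n\le s<t\le jh_n,\ l=1,2)$ for $0\le i,j\le n$, and $$\alpha_k^n=0\vee\sup_{1\le i,j\le n-1,\ j-i\ge k}\ \sup_{A\in\mathcal G^n_{0,i}}\ \sup_{B\in\mathcal G^n_{j,n}}|P(A\cap B)-P(A)P(B)|.$$ $\mathbb Z_+=\{0,1,2,\dots\}$, $\mathbb N=\{1,2,\dots\}$. *)

(* Defs.v *)
From HB Require Import structures.
From mathcomp Require Import all_boot all_order all_algebra.
From mathcomp Require Import all_classical all_reals all_analysis.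

Set Implicit Arguments.
Unset Strict Implicit.
Unset Printing Implicit Defensive.

Import Order.TTheory GRing.Theory Num.Theory.
Import numFieldNormedType.Exports.

Local Open Scope classical_set_scope.
Local Open Scope ring_scope.

(* The index l = 1, 2 is shifted to 'I_2 = {0, 1}. *)
Definition comp1 : 'I_2 := ord0.
Definition comp2 : 'I_2 := ord_max.

(* One realization of the sampling times: component [l] is observed at
   [S l 0 < S l 1 < ... < S l (M l)]; [S l i] is meaningless for [i > M l].
   The row/column index [i : 'I_(M l)] stands for the (i+1)-st interval. *)
Section Realization.
Context {R : realType} (S : 'I_2 -> nat -> R) (M : 'I_2 -> nat).

Definition obs_itv (l : 'I_2) (i : nat) : set R :=
  [set` `]S l i, S l i.+1]].

Definition itv_length (A : set R) : R := fine (lebesgue_measure A).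

Definition sqrt_len (l : 'I_2) : 'cV[R]_(M l) :=
  \col_(i < M l) Num.sqrt (itv_length (obs_itv l i)).

Definition Gmx : 'M[R]_(M comp1, M comp2) :=
  \matrix_(i < M comp1, j < M comp2)
    (itv_length (obs_itv comp1 i `&` obs_itv comp2 j) /
     (Num.sqrt (itv_length (obs_itv comp1 i)) * Num.sqrt (itv_length (obs_itv comp2 j)))).

(* Only used for k >= 1. *)
Definition Emx (s : nat -> R) (l : 'I_2) (k : nat) : 'M[R]_(M l) :=
  diag_mx (\row_(i < M l) (s k.-1 < sup (obs_itv l i) <= s k)%R%:R).

Definition form11 (s : nat -> R) (p k : nat) : R :=
  ((sqrt_len comp1)^T *m Emx s comp1 k *m (Gmx *m Gmx^T) ^+ p *m sqrt_len comp1)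
    ord0 ord0.

Definition form12 (s : nat -> R) (p k : nat) : R :=
  ((sqrt_len comp1)^T *m Emx s comp1 k *m (Gmx *m Gmx^T) ^+ p *m Gmx *m sqrt_len comp2)
    ord0 ord0.

Definition form22 (s : nat -> R) (p k : nat) : R :=
  ((sqrt_len comp2)^T *m Emx s comp2 k *m (Gmx^T *m Gmx) ^+ p *m sqrt_len comp2)
    ord0 ord0.

Definition counting_proc (l : 'I_2) (t : R) : R :=
  \sum_(1 <= i < (M l).+1) (S l i <= t)%R%:R.

End Realization.

Section Partitions.
Context {R : realType}.

Definition partitions : set (nat -> R) :=
  [set s | [/\ s 0%N = 0, (forall k, s k < s k.+1), s @ \oo --> +oo,
    (ereal_sup [set `|s k - s k.-1|%:E | k in [set k | (1 <= k)%N]] <= 1)%E &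
    (0 < ereal_inf [set `|s k - s k.-1|%:E | k in [set k | (1 <= k)%N]])%E]].

(* The set below is finite and nonempty when s \in partitions and
   0 <= h n, so that its supremum is its maximum. *)
Definition qidx (h : nat -> R) (s : nat -> R) (n : nat) : nat :=
  supremum 0%N [set k | s k <= n%:R * h n].

End Partitions.

Section Probability.
Context {d : measure_display} {T : measurableType d} {R : realType}.
Variable P : probability T R.

Definition cvg_in_probability (X : nat -> T -> R) (c : R) : Prop :=
  forall e : R, 0 < e ->
    (fun n => P [set w | e < `|X n w - c|]) @ \oo --> 0%E.

Section Blocks.
Variables (h s : nat -> R) (X : nat -> nat -> T -> R) (f : R).

(* The bigmax default 0 only matters when qidx h s n = 0; the terms are
   nonnegative. *)
Definition mean_block_cvg : Prop :=
  (fun n => \big[maxe/0]_(1 <= k < (qidx h s n).+1)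
     `|'E_P[X n k] - (f * (s k - s k.-1))%:E|)%E @ \oo --> 0%E.

Definition prob_block_cvg : Prop :=
  cvg_in_probability
    (fun n w => \big[Num.max/0]_(1 <= k < (qidx h s n).+1)
       `|X n k w - f * (s k - s k.-1)|) 0.

End Blocks.

Section Sampling.
Variables (h : nat -> R) (S : nat -> 'I_2 -> nat -> T -> R)
  (M : nat -> 'I_2 -> T -> nat).

Definition N_ (n : nat) (l : 'I_2) (t : R) (w : T) : R :=
  counting_proc (fun l i => S n l i w) (fun l => M n l w) l t.

Definition X11 (s : nat -> R) (p n k : nat) (w : T) : R :=
  form11 (fun l i => S n l i w) (fun l => M n l w) s p k.

Definition X12 (s : nat -> R) (p n k : nat) (w : T) : R :=
  form12 (fun l i => S n l i w) (fun l => M n l w) s p k.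

Definition X22 (s : nat -> R) (p n k : nat) (w : T) : R :=
  form22 (fun l i => S n l i w) (fun l => M n l w) s p k.

Definition B1 (q : R) : Prop :=
  (ereal_sup [set \big[maxe/-oo]_(l < 2)
     ereal_sup [set 'E_P[fun w => ((N_ n l (t + h n) w - N_ n l t w) `^ q)%R]
       | t in [set t : R | (0 <= t <= (n%:R - 1) * h n)%R]]
     | n in [set n | (1 <= n)%N]] < +oo)%E.

(* For fixed u, the inner supremum is -oo when n < u; it is nonnegative for
   n >= u, so these n do not affect the supremum over n. *)
Definition B2 (q : R) : Prop :=
  (limf_esup (fun u : R =>
     ereal_sup [set \big[maxe/-oo]_(l < 2)
       ereal_sup [set (u `^ q)%R%:E *
           P [set w | (N_ n l (t + u * h n) w - N_ n l t w)%R = 0%R]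
         | t in [set t : R | (0 <= t <= n%:R * h n - u * h n)%R]]
       | n in [set n | (1 <= n)%N]]) +oo%R < +oo)%E.

Definition sigmaG (n i j : nat) : set (set T) :=
  <<s [set A | exists (l : 'I_2) (s t : R),
         [/\ i%:R * h n <= s, s < t, t <= j%:R * h n &
           preimage_set_system setT
             (fun w => N_ n l t w - N_ n l s w) measurable A]] >>.

Definition alpha (n k : nat) : \bar R :=
  maxe (0 : \bar R) (ereal_sup [set x | exists i j : nat,
    [/\ (1 <= i <= n.-1)%N, (1 <= j <= n.-1)%N, (i + k <= j)%N &
      exists A B, [/\ sigmaG n 0 i A, sigmaG n j n B &
        x = `|P (A `&` B) - P A * P B|]]])%E.

Definition mixing_summable (q : R) : Prop :=
  (ereal_sup [set \sum_(0 <= k <oo) (k.+1%:R `^ q)%R%:E * alpha n k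
     | n in [set n | (1 <= n)%N]] < +oo)%E.

Definition sampling_times : Prop :=
  forall (n : nat) (l : 'I_2) (w : T), (1 <= n)%N ->
    [/\ (1 <= M n l w)%N, S n l 0%N w = 0,
        (forall i, (i < M n l w)%N -> S n l i w < S n l i.+1 w) &
        S n l (M n l w) w = n%:R * h n].

End Sampling.
End Probability.

(* Main.v *)
Require Import Defs.
From HB Require Import structures.
From mathcomp Require Import all_boot all_order all_algebra.
From mathcomp Require Import all_classical all_reals all_analysis.
From mathcomp Require Import measurable_realfun ring lra.
Import Order.TTheory GRing.Theory Num.Theory.
Import numFieldNormedType.Exports.
Local Open Scope classical_set_scope.
Local Open Scope ring_scope.

(** The two grids cover the same interval (0, T_n], T_n = n h_n.  Summing
    |I_i^1 `&` I_j^2| over j therefore gives |I_i^1|, which says that G sends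
    the vector of square-root lengths of the second grid to that of the first,
    and G^T sends it back ([Gmx_sqrt_len], [GmxT_sqrt_len]).  Hence G G^T and
    G^T G fix these vectors, and the three quadratic forms do not depend on p:
    each is the total length of the intervals of one grid whose right endpoint
    lies in (s_{k-1}, s_k] ([form11E], [form12E], [form22E]).  If tau(t)
    denotes the last grid point up to t, this length is
    tau(s_k) - tau(s_{k-1}), so the limiting constants are all 1 and only the
    lags t - tau(t) at t = s_0, ..., s_{q_n} have to be controlled.

    If both lags are at most e, then so is the error on the block
    ([block_length_approx]).  A lag exceeding e at t means that no point falls
    in (t - e, t], i.e. that the counting process does not move there; by [B2]
    for q = 1, with u = e / h_n, this has probability O(h_n) for fixed e
    ([void_event_prob]).  The gaps of the partition are bounded below, so
    q_n = O(n h_n), and the union bound over the blocks gives O(n h_n^2),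
    which tends to 0 ([block_cvg]). *)

(** * Lengths of intervals of a finite grid *)

Section Grid.
Context {R : realType}.

Definition grid (tau : R) (S : nat -> R) (m : nat) : Prop :=
  [/\ S 0%N = 0, (forall i, (i < m)%N -> S i < S i.+1) & S m = tau].

Lemma grid_mono (tau : R) (S : nat -> R) (m i j : nat) :
  grid tau S m -> (i <= j <= m)%N -> S i <= S j.
Proof.
case=> _ Sinc _ /andP[ij jm].
have H k : (i + k <= m)%N -> S i <= S (i + k)%N.
  elim: k => [|k IH]; first by rewrite addn0.
  rewrite addnS => km; apply: le_trans (IH (ltnW km)) (ltW _).
  exact: Sinc.
by rewrite -(subnKC ij); apply: H; rewrite subnKC.
Qed.

(** For [a <= b], the projection of [x] on [a, b]: the length of the
    intersection of (a, b] with (c, e] is its increment from [c] to [e], which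
    makes sums over a grid telescope. *)
Definition clip (a b x : R) : R := Num.min b (Num.max a x).

Lemma itv_length_oc (a b : R) : a <= b -> itv_length [set` `]a, b]] = b - a.
Proof.
move=> ab; rewrite /itv_length lebesgue_measure_itv /= lte_fin.
by case: ltP => // ba; have -> : a = b; [apply/le_anti/andP|rewrite subrr].
Qed.

Lemma itv_length_ocI (a b c e : R) : a <= b -> c <= e ->
  itv_length ([set` `]a, b]] `&` [set` `]c, e]]) = clip a b e - clip a b c.
Proof.
move=> ab ce; rewrite -set_itvI /itv_length lebesgue_measure_itv /= lte_fin.
rewrite /clip meetEtotal joinEtotal.
by case: ltP => /=; rewrite !minEle !maxEle;
  case: (leP a e) => ?; case: (leP a c) => ?; case: (leP b a) => ?;
  case: (leP b e) => ?; case: (leP b c) => ?; lra.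
Qed.

Lemma sum_itv_length_grid (tau : R) (S : nat -> R) (m : nat) (a b : R) :
  grid tau S m -> 0 <= a -> a <= b -> b <= tau ->
  \sum_(i < m) itv_length ([set` `]a, b]] `&` [set` `]S i, S i.+1]]) = b - a.
Proof.
move=> gS a0 ab bt; have [S0 Sinc Sm] := gS.
rewrite -(big_mkord xpredT (fun i => itv_length (_ `&` [set` `]S i, S i.+1]]))).
rewrite (telescope_sumr_eq (fun i => clip a b (S i))) //; last first.
  by move=> k /andP[_ km]; rewrite itv_length_ocI // ltW // Sinc.
rewrite S0 Sm /clip !minEle !maxEle.
case: (leP a 0) => ?; case: (leP a tau) => ?; case: (leP b 0) => ?;
  case: (leP b a) => ?; case: (leP b tau) => ?; lra.
Qed.

Definition block_length (S : nat -> R) (m : nat) (a b : R) : R :=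
  \sum_(i < m) (a < S i.+1 <= b)%R%:R * (S i.+1 - S i).

(** On a grid starting at 0 this is the last grid point up to [t], written as a
    sum so that it is compared with [block_length] term by term. *)
Definition last_obs (S : nat -> R) (m : nat) (t : R) : R :=
  \sum_(i < m) (S i.+1 <= t)%R%:R * (S i.+1 - S i).

Lemma block_lengthE (S : nat -> R) (m : nat) (a b : R) : a <= b ->
  block_length S m a b = last_obs S m b - last_obs S m a.
Proof.
move=> ab; rewrite /block_length /last_obs -sumrB; apply: eq_bigr => i _.
rewrite -mulrBl; congr (_ * _).
by case: (leP _ a) => ? /=; case: (leP _ b) => ? /=; lra.
Qed.

(** Each term is at most the increment of [Num.min (S i) t]. *)
Lemma last_obs_le (tau : R) (S : nat -> R) (m : nat) (t : R) :
  grid tau S m -> 0 <= t -> last_obs S m t <= t.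
Proof.
move=> [S0 Sinc Sm] t0.
apply: (@le_trans _ _ (Num.min (S m) t - Num.min (S 0%N) t)); last first.
  by rewrite S0 Sm !minEle; case: (leP tau t) => ?; case: (leP 0 t) => ?; lra.
rewrite -(telescope_sumr (fun i => Num.min (S i) t)) // big_mkord.
apply: ler_sum => i _; have := Sinc _ (ltn_ord i).
rewrite !minEle; case: (leP (S i.+1) t) => ? /=.
  by case: (leP (S i) t) => ? ?; lra.
by case: (leP (S i) t) => ? ?; lra.
Qed.

(** The terms before index [j] already add up to [S j]. *)
Lemma last_obs_ge (tau : R) (S : nat -> R) (m j : nat) (t : R) :
  grid tau S m -> (j <= m)%N -> S j <= t -> S j <= last_obs S m t.
Proof.
move=> gS jm Sjt; have [S0 Sinc Sm] := gS.
rewrite /last_obs.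
rewrite -(big_mkord xpredT (fun i => (S i.+1 <= t)%R%:R * (S i.+1 - S i))).
rewrite (big_cat_nat (n := j)) //=.
rewrite (telescope_sumr_eq S) //; last first.
  move=> k /andP[_ kj]; rewrite (le_trans _ Sjt) ?mul1r //.
  by apply: grid_mono gS _; rewrite kj.
rewrite S0 subr0 lerDl big_nat sumr_ge0 // => i /andP[_ im].
by rewrite mulr_ge0 // ?ler0n // subr_ge0 ltW // Sinc.
Qed.

(** Both [last_obs S m a] and [last_obs S m b] fall short of [a] and [b] by an
    amount between 0 and [e], and these two shortfalls enter the difference
    with opposite signs. *)
Lemma block_length_approx (tau : R) (S : nat -> R) (m : nat) (a b e : R) :
  grid tau S m -> 0 <= a -> a <= b ->
  (exists2 i, (i <= m)%N & a - e <= S i <= a) ->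
  (exists2 j, (j <= m)%N & b - e <= S j <= b) ->
  `|block_length S m a b - (b - a)| <= e.
Proof.
move=> gS a0 ab [i im /andP[ai ia]] [j jm /andP[bj jb]].
rewrite block_lengthE // ler_norml.
have := last_obs_le _ _ _ _ gS a0.
have := last_obs_le _ _ _ _ gS (le_trans a0 ab).
have := last_obs_ge _ _ _ _ _ gS im ia.
have := last_obs_ge _ _ _ _ _ gS jm jb.
lra.
Qed.

End Grid.

(** * Reduction of the quadratic forms to block lengths *)

Section Forms.
Context {R : realType} (tau : R) (S : 'I_2 -> nat -> R) (M : 'I_2 -> nat).
Hypothesis gridS : forall l, grid tau (S l) (M l).

Lemma obs_itv_length (l : 'I_2) (i : nat) : (i < M l)%N ->
  itv_length (obs_itv S l i) = S l i.+1 - S l i.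
Proof. by case: (gridS l) => _ H _ iM; rewrite itv_length_oc // ltW ?H. Qed.

Lemma obs_itv_length_gt0 (l : 'I_2) (i : nat) : (i < M l)%N ->
  0 < itv_length (obs_itv S l i).
Proof.
by move=> iM; rewrite obs_itv_length // subr_gt0; case: (gridS l) => _ ->.
Qed.

(** Both grids cover the same interval [`]0, tau]], so the intervals of [l'] cut
    each interval of [l] into pieces without loss. *)
Lemma sum_obs_itvI (l l' : 'I_2) (i : nat) : (i < M l)%N ->
  \sum_(j < M l') itv_length (obs_itv S l i `&` obs_itv S l' j) =
  itv_length (obs_itv S l i).
Proof.
move=> iM; rewrite obs_itv_length //; have [S0 Sinc Sm] := gridS l.
apply: (sum_itv_length_grid tau) => //.
- by rewrite -S0; apply: grid_mono (gridS l) _; rewrite (ltnW iM).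
- by rewrite ltW // Sinc.
- by rewrite -Sm; apply: grid_mono (gridS l) _; rewrite iM leqnn.
Qed.

(** The factor [|I_j^2|^(1/2)] of the vector cancels the one in the
    denominator of [G], leaving the sum of the intersection lengths divided by
    [|I_i^1|^(1/2)]. *)
Lemma Gmx_sqrt_len :
  Gmx S M *m sqrt_len S M comp2 = sqrt_len S M comp1.
Proof.
apply/matrixP => i k; rewrite !mxE.
under eq_bigr => j _.
  rewrite !mxE.
  have sj : Num.sqrt (itv_length (obs_itv S comp2 j)) != 0.
    by rewrite gt_eqF // sqrtr_gt0 obs_itv_length_gt0.
  rewrite invfM mulrA mulfVK //.
  over.
rewrite -mulr_suml sum_obs_itvI //.
have si := obs_itv_length_gt0 comp1 i (ltn_ord i).
by rewrite -{1}(sqr_sqrtr (ltW si)) expr2 mulfK // gt_eqF // sqrtr_gt0.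
Qed.

Lemma GmxT_sqrt_len :
  (Gmx S M)^T *m sqrt_len S M comp1 = sqrt_len S M comp2.
Proof.
apply/matrixP => i k; rewrite !mxE.
under eq_bigr => j _.
  rewrite !mxE setIC.
  have sj : Num.sqrt (itv_length (obs_itv S comp1 j)) != 0.
    by rewrite gt_eqF // sqrtr_gt0 obs_itv_length_gt0.
  rewrite invfM (mulrC _^-1) mulrA mulfVK //.
  over.
rewrite -mulr_suml sum_obs_itvI //.
have si := obs_itv_length_gt0 comp2 i (ltn_ord i).
by rewrite -{1}(sqr_sqrtr (ltW si)) expr2 mulfK // gt_eqF // sqrtr_gt0.
Qed.

Lemma expmx_fix (m : nat) (A : 'M[R]_m) (v : 'cV[R]_m) (p : nat) :
  A *m v = v -> A ^+ p *m v = v.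
Proof.
move=> Av; elim: p => [|p IH]; first by rewrite expr0 mul1mx.
by rewrite exprS -mulmxE -mulmxA IH.
Qed.

Lemma sqrt_len_Emx (s : nat -> R) (l : 'I_2) (k : nat) :
  ((sqrt_len S M l)^T *m Emx S M s l k *m sqrt_len S M l) ord0 ord0 =
  block_length (S l) (M l) (s k.-1) (s k).
Proof.
rewrite /Emx mul_mx_diag mxE; apply: eq_bigr => i _; rewrite !mxE.
rewrite /obs_itv sup_itv; last first.
  by case: (gridS l) => _ H _; rewrite bnd_simp H.
rewrite -/(obs_itv S l i) mulrC mulrA -expr2.
rewrite sqr_sqrtr ?(ltW (obs_itv_length_gt0 _ _ _)) //.
by rewrite obs_itv_length // mulrC.
Qed.

Lemma form11E (s : nat -> R) (p k : nat) :
  form11 S M s p k = block_length (S comp1) (M comp1) (s k.-1) (s k).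
Proof.
rewrite /form11 -mulmxA expmx_fix ?sqrt_len_Emx //.
by rewrite -mulmxA GmxT_sqrt_len Gmx_sqrt_len.
Qed.

Lemma form12E (s : nat -> R) (p k : nat) :
  form12 S M s p k = block_length (S comp1) (M comp1) (s k.-1) (s k).
Proof. by rewrite -(form11E s p) /form12 -mulmxA Gmx_sqrt_len. Qed.

Lemma form22E (s : nat -> R) (p k : nat) :
  form22 S M s p k = block_length (S comp2) (M comp2) (s k.-1) (s k).
Proof.
rewrite /form22 -mulmxA expmx_fix ?sqrt_len_Emx //.
by rewrite -mulmxA Gmx_sqrt_len GmxT_sqrt_len.
Qed.

End Forms.

(** * Lags and the counting process *)

Section CountingGap.
Context {R : realType}.

(** If the counting process moves on (t - e, t], it has a jump there.  When
    [t < e] the initial point 0 plays this part; the observation window of the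
    process could not be used there, since it would start at a negative
    time. *)
Lemma point_in_gap (tau : R) (S : 'I_2 -> nat -> R) (M : 'I_2 -> nat)
    (l : 'I_2) (t e : R) :
  grid tau (S l) (M l) -> 0 <= e -> 0 <= t ->
  ~~ ((e <= t) && (counting_proc S M l t - counting_proc S M l (t - e) == 0)) ->
  exists2 i, (i <= M l)%N & t - e <= S l i <= t.
Proof.
move=> [S0 _ _] e0 t0; rewrite negb_and -ltNge => /orP[te|Nt].
  by exists 0%N => //; rewrite S0 t0 subr_le0 ltW.
apply: contrapT => nopoint; move/eqP: Nt; apply; apply/eqP.
rewrite subr_eq0 /counting_proc; apply/eqP; apply: eq_big_nat => i /andP[_ iM].
case: (leP (S l i) t) => Sit; case: (leP (S l i) (t - e)) => Site //;
  last by lra.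
by case: nopoint; exists i => //; rewrite (ltW Site).
Qed.

End CountingGap.

(** * Measurability with a random number of points *)

Section Measurability.
Context {d : measure_display} {T : measurableType d} {R : realType}.

(** The index takes countably many values, so it is enough to look at the
    events where it is constant. *)
Lemma measurable_random_index (M : T -> nat) (F : nat -> T -> R) :
  measurable_fun setT M -> (forall m, measurable_fun setT (F m)) ->
  measurable_fun setT (fun w => F (M w) w).
Proof.
move=> mM mF.
have -> : [set: T] = \bigcup_m (M @^-1` [set m]).
  by apply/seteqP; split => // w _; exists (M w).
have mE m : measurable (M @^-1` [set m]).
  by rewrite -[X in measurable X]setTI; exact: mM.
apply/measurable_fun_bigcup => // m.
apply: (eq_measurable_fun (F m)); last exact: measurable_funTS.
by move=> w; rewrite inE /= => ->.
Qed.

Lemma measurable_natr_bool (b : T -> bool) :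
  measurable_fun setT b -> measurable_fun setT (fun w => (b w)%:R : R).
Proof.
move=> mb.
exact: (@measurableT_comp _ _ _ _ _ _ (fun b : bool => b%:R : R)).
Qed.

Context (S : nat -> T -> R) (M : T -> nat).
Hypothesis mS : forall i, measurable_fun setT (S i).
Hypothesis mM : measurable_fun setT M.

Lemma measurable_block_length (a b : R) :
  measurable_fun setT (fun w => block_length (S^~ w) (M w) a b).
Proof.
apply: (measurable_random_index M
  (fun m w => block_length (S^~ w) m a b)) => // m.
apply: measurable_sum => i; apply: measurable_funM; last exact: measurable_funB.
apply/measurable_natr_bool/measurable_and.
  exact: measurable_fun_ltr.
exact: measurable_fun_ler.
Qed.

Lemma measurable_count (t : R) :
  measurable_fun setT
    (fun w => \sum_(1 <= i < (M w).+1) (S i w <= t)%R%:R : R).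
Proof.
apply: (measurable_random_index M (fun m w => \sum_(1 <= i < m.+1) _)) => // m.
apply: measurable_sum => i; apply/measurable_natr_bool.
exact: measurable_fun_ler.
Qed.

End Measurability.

(** * Number of blocks of a partition *)

Section PartitionBounds.
Context {R : realType}.

Lemma partition_step (s : nat -> R) : partitions s ->
  exists2 delta : R, 0 < delta & forall k, s k + delta <= s k.+1.
Proof.
move=> [s0 sinc _ _]; set I := ereal_inf _ => I0.
have lbI k : (I <= (s k.+1 - s k)%:E)%E.
  rewrite -[s k.+1 - s k]gtr0_norm ?subr_gt0 //.
  by apply: ereal_inf_lbound; exists k.+1.
case: I I0 lbI => [r| |] // r0 lbI; last by have := lbI 0%N.
exists r => [//|k]; have := lbI k; rewrite lee_fin; lra.
Qed.

Lemma partition_linear (s : nat -> R) (delta : R) : s 0%N = 0 ->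
  (forall k, s k + delta <= s k.+1) -> forall k, k%:R * delta <= s k.
Proof.
move=> s0 sd; elim=> [|k IH]; first by rewrite mul0r s0.
by apply: le_trans (sd k); rewrite -natr1 mulrDl mul1r lerD2r.
Qed.

(** As [s] grows at least linearly, the set defining [qidx] is finite, and its
    supremum is attained. *)
Lemma qidx_le (h s : nat -> R) (n : nat) : partitions s -> 0 <= n%:R * h n ->
  s (qidx h s n) <= n%:R * h n.
Proof.
move=> ps nh0; have [s0 _ _ _ _] := ps.
have [delta d0 sd] := partition_step s ps.
rewrite /qidx /supremum; set A := [set k | _].
have A0 : A 0%N by rewrite /A /= s0.
rewrite ifF; last by apply/negbTE/set0P; exists 0%N.
have ubA : ubound A (Num.bound (n%:R * h n / delta)).
  move=> k Ak; rewrite leEnat -(ler_nat R); apply: ltW.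
  apply: le_lt_trans (archi_boundP _); last by rewrite divr_ge0 // ltW.
  rewrite ler_pdivlMr //; apply: le_trans Ak.
  exact: partition_linear.
have [m mA mub] : exists2 m, A m & ubound A m.
  have exA : exists k, `[< A k >] by exists 0%N; apply/asboolP.
  have bA k : `[< A k >] -> (k <= Num.bound (n%:R * h n / delta))%N.
    by move/asboolP/ubA.
  case: (ex_maxnP exA bA) => m /asboolP Am H.
  by exists m => // k /asboolP /H.
case: xgetP => [y _ [yub ylb]|/(_ m)[]].
  have -> // : y = m.
  by apply: le_anti; rewrite (ylb _ mub) (yub _ mA).
by split => // y; apply.
Qed.

End PartitionBounds.

(** * Concentration of the block lengths *)

Section Concentration.
Context {d : measure_display} {T : measurableType d} {R : realType}
  (P : probability T R) (h : nat -> R) (S : nat -> 'I_2 -> nat -> {RV P >-> R})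
  (M : nat -> 'I_2 -> {RV P >-> nat}).
Hypothesis h_gt0 : forall n, (1 <= n)%N -> 0 < h n.
Hypothesis S_times : sampling_times h S M.

Lemma grid_sampling_times (n : nat) (l : 'I_2) (w : T) : (1 <= n)%N ->
  grid (n%:R * h n) (fun i => S n l i w) (M n l w).
Proof. by move=> n1; have [_ ? ? ?] := S_times n l w n1. Qed.

Lemma measurable_N_ (n : nat) (l : 'I_2) (t : R) :
  measurable_fun setT (N_ S M n l t).
Proof.
apply: (measurable_count (fun i => S n l i) (M n l)) => //.
Qed.

Lemma void_prob_le : B2 P h S M 1 ->
  exists U C : R, 0 <= C /\ forall u n l t, U < u -> 0 < u -> (1 <= n)%N ->
    0 <= t <= n%:R * h n - u * h n ->
    (P [set w | (N_ S M n l (t + u * h n) w - N_ S M n l t w)%R = 0%R]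
      <= (C / u)%:E)%E.
Proof.
move=> /ereal_inf_lt[_ [V [U [_ UV]] <-]] supV.
have [C C0 supC] : exists2 C : R, 0 <= C & (ereal_sup [set (fun u : R =>
     ereal_sup [set \big[maxe/-oo]_(l < 2)
       ereal_sup [set (u `^ 1)%R%:E *
           P [set w | (N_ S M n l (t + u * h n) w - N_ S M n l t w)%R = 0%R]
         | t in [set t : R | (0 <= t <= n%:R * h n - u * h n)%R]]
       | n in [set n | (1 <= n)%N]])%E x | x in V] <= C%:E)%E.
  move: supV; case: (ereal_sup _) => [r| |] // _.
    by exists (Num.max 0 r); rewrite ?lee_fin le_max lexx ?orbT.
  by exists 0; rewrite ?leNye.
exists U, C; split=> // u n l t Uu u0 n1 tn.
have -> : (C / u)%:E = (u^-1%:E * C%:E)%E by rewrite -EFinM mulrC.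
rewrite lee_pdivlMl // -{1}(powRr1 (ltW u0)).
apply: le_trans supC.
apply: le_trans; last first.
  by apply: ereal_sup_ubound; exists u; [exact: UV|reflexivity].
apply: le_trans; last first.
  by apply: ereal_sup_ubound; exists n; [exact: n1|reflexivity].
apply: (@bigmax_sup _ _ _ _ l) => //.
by apply: ereal_sup_ubound; exists t.
Qed.

(** The condition [e <= t] keeps the window (t - e, t] inside the range of
    times of [B2]; for smaller [t] the lag is below [e] anyway. *)
Definition void_event (n : nat) (l : 'I_2) (e t : R) : set T :=
  [set w | (e <= t) && (N_ S M n l t w - N_ S M n l (t - e) w == 0)].

Lemma measurable_void_event (n : nat) (l : 'I_2) (e t : R) :
  measurable (void_event n l e t).
Proof.
rewrite /void_event; case: (e <= t); last first.
  by rewrite (_ : [set _ | _] = set0) //; apply/seteqP; split.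
rewrite -[X in measurable X]setTI.
have := measurable_funB (measurable_N_ n l t) (measurable_N_ n l (t - e)).
move=> /(_ measurableT [set 0] (measurable_set1 _)).
congr (measurable (_ `&` _)); apply/seteqP.
by split=> w /= /eqP.
Qed.

Definition block (l : 'I_2) (s : nat -> R) (n k : nat) (w : T) : R :=
  block_length (fun i => S n l i w) (M n l w) (s k.-1) (s k).

Lemma measurable_block (l : 'I_2) (s : nat -> R) (n k : nat) :
  measurable_fun setT (block l s n k).
Proof. exact: (measurable_block_length (fun i => S n l i) (M n l)). Qed.

Definition bad_event (l : 'I_2) (s : nat -> R) (e : R) (n k : nat) : set T :=
  [set w | e < `|block l s n k w - (s k - s k.-1)|].

Lemma measurable_bad_event (l : 'I_2) (s : nat -> R) (e : R) (n k : nat) :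
  measurable (bad_event l s e n k).
Proof.
rewrite /bad_event -[X in measurable X]setTI.
apply: (@measurable_fun_ltr _ _ _ _ (cst e)
  (fun w => `|block l s n k w - (s k - s k.-1)|)
  _ _ measurableT [set true]) => //.
apply: (@measurableT_comp _ _ _ _ _ _ (@Num.norm _ R)) => //.
by apply: measurable_funB => //; exact: measurable_block.
Qed.

Lemma bad_event_sub (l : 'I_2) (s : nat -> R) (e : R) (n k : nat) :
  (1 <= n)%N -> 0 <= e -> 0 <= s k.-1 -> s k.-1 <= s k ->
  bad_event l s e n k `<=` void_event n l e (s k.-1) `|` void_event n l e (s k).
Proof.
move=> n1 e0 sk0 sk w; rewrite /bad_event /= => ew.
apply: contrapT => /not_orP[/negP nv1 /negP nv2].
have gS := grid_sampling_times n l w n1.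
move: ew; rewrite ltNge => /negP; apply.
apply: (block_length_approx _ _ _ _ _ _ gS) => //.
  exact: (point_in_gap _ (fun l i => S n l i w) (fun l => M n l w) l _ _ gS).
apply: (point_in_gap _ (fun l i => S n l i w) (fun l => M n l w)
  l _ _ gS) => //.
exact: le_trans sk.
Qed.

Hypothesis h_cvg0 : h @ \oo --> (0 : R).
Hypothesis nh2_cvg0 : (fun n => n%:R * h n ^+ 2) @ \oo --> (0 : R).
Hypothesis hB2 : B2 P h S M 1.

(** With [u = e / h n], which tends to infinity, the window of length [u * h n]
    is exactly (t - e, t], and the bound [C / u] is of order [h n]. *)
Lemma void_event_prob (l : 'I_2) (e : R) : 0 < e ->
  exists2 C : R, 0 <= C & \forall n \near \oo, forall t, 0 <= t <= n%:R * h n ->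
    (P (void_event n l e t) <= (C * h n)%:E)%E.
Proof.
move=> e0; have [U [C [C0 HU]]] := void_prob_le hB2.
exists (C / e); first by rewrite divr_ge0 // ltW.
(* [`|U| + 1] is a positive bound above [U], whatever the sign of [U]. *)
have hsmall : \forall n \near \oo, h n < e / (`|U| + 1).
  by apply: cvgr_lt h_cvg0 _ _; rewrite divr_gt0 // ltr_wpDl.
near=> n => t /andP[t0 tn].
have n1 : (1 <= n)%N by near: n; exact: nbhs_infty_ge.
have hn := h_gt0 n n1.
rewrite /void_event; case: (leP e t) => et; last first.
  rewrite (_ : [set _ | _] = set0) ?measure0; last by apply/seteqP; split.
  by rewrite lee_fin !mulr_ge0 ?invr_ge0 // ltW.
have eh : e / h n * h n = e by rewrite mulfVK // gt_eqF.
have := HU (e / h n) n l (t - e).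
rewrite eh subrK invf_div mulrA (mulrAC C) => HP.
rewrite (_ : [set _ | _] =
  [set w | N_ S M n l t w - N_ S M n l (t - e) w = 0]); last first.
  by apply/seteqP; split=> w /= /eqP.
apply: HP => //; last 1 first.
- by rewrite subr_ge0 et lerB.
- apply: le_lt_trans (ler_norm U) _; rewrite ltr_pdivlMr //.
  have : h n < e / (`|U| + 1) by near: n.
  rewrite ltr_pdivlMr ?ltr_wpDl // mulrDr mulr1 => H.
  by rewrite mulrC (lt_trans _ H) // ltrDl.
- by rewrite divr_gt0.
Unshelve. all: by end_near. Qed.

(** Every block with a large error has a void window at one of its two ends.
    There are at most [n%:R * h n / delta] blocks, where [delta] bounds the
    gaps of [s] from below, and each end costs [C * h n]. *)
Lemma block_cvg (l : 'I_2) (s : nat -> R) : partitions s ->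
  prob_block_cvg P h s (block l s) 1.
Proof.
move=> ps e e0; have [s0 sinc _ _ _] := ps.
have [delta d0 sd] := partition_step s ps.
have slin := partition_linear s delta s0 sd.
have smono : {homo s : i j / (i <= j)%N >-> i <= j}.
  by apply/nondecreasing_seqP => k; exact: ltW.
have sk0 k : 0 <= s k by rewrite -s0 smono.
have [C C0 void_le] := void_event_prob l e e0.
set D := 2 * C / delta.
apply: (@squeeze_cvge _ _ _ _ (cst 0%E) _
  (fun n => (D * (n%:R * h n ^+ 2))%:E)); last 2 first.
- exact: cvg_cst.
- have -> : 0%E = (D * 0)%:E :> \bar R by rewrite mulr0.
  by apply: cvg_EFin; [exact: nearW|exact: cvgMl_tmp].
near=> n; rewrite measure_ge0 /=.
have n1 : (1 <= n)%N by near: n; exact: nbhs_infty_ge.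
have hn := h_gt0 n n1.
have nh0 : 0 <= n%:R * h n by rewrite mulr_ge0 // ltW.
have void_le_n : forall t, 0 <= t <= n%:R * h n ->
    (P (void_event n l e t) <= (C * h n)%:E)%E by near: n.
set q := qidx h s n.
have sq : s q <= n%:R * h n := qidx_le h s n ps nh0.
have -> : [set w | e < `|\big[Num.max/0]_(1 <= k < q.+1)
    `|block l s n k w - 1 * (s k - s k.-1)| - 0|] =
    \big[setU/set0]_(k < q) bad_event l s e n k.+1.
  rewrite -(bigcup_mkord q (fun k => bad_event l s e n k.+1)).
  apply/seteqP; split => w /=.
    rewrite subr0 ger0_norm ?bigmax_ge_id // big_add1 big_mkord.
    move/bigmax_gtP => [|[k _]]; first by rewrite ltNge (ltW e0).
    by rewrite mul1r => ek; exists (k : nat) => //=.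
  move=> [k kq ek]; rewrite subr0 ger0_norm ?bigmax_ge_id // big_add1 big_mkord.
  apply/bigmax_gtP; right; exists (Ordinal kq) => //=.
  by rewrite mul1r.
apply: le_trans (Boole_inequality P (A := fun k => bad_event l s e n k.+1) _) _.
  by move=> k _; exact: measurable_bad_event.
apply: (@le_trans _ _ (\sum_(k < q) (2 * C * h n)%:E)%E).
  apply: lee_sum => k _.
  have sle j : (j <= q)%N -> 0 <= s j <= n%:R * h n.
    by move=> jq; rewrite sk0 (le_trans _ sq) ?smono.
  apply: (@le_trans _ _
    (P (void_event n l e (s k) `|` void_event n l e (s k.+1)))).
    apply: le_measure; rewrite ?inE.
    - exact: measurable_bad_event.
    - by apply: measurableU; exact: measurable_void_event.
    - by apply: bad_event_sub => //; [exact: ltW|exact: smono].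
  apply: le_trans (measureU2 _ _ _) _; try exact: measurable_void_event.
  have -> : (2 * C * h n)%:E = ((C * h n)%:E + (C * h n)%:E)%E.
    by rewrite -EFinD; congr EFin; ring.
  by apply: leeD; apply: void_le_n; apply: sle; [exact: ltnW|].
rewrite sumEFin lee_fin sumr_const card_ord -[_ *+ q]mulr_natr.
have qd : q%:R <= n%:R * h n / delta.
  by rewrite ler_pdivlMr // (le_trans (slin q)).
apply: (@le_trans _ _ (2 * C * h n * (n%:R * h n / delta))).
  by rewrite ler_wpM2l // !mulr_ge0 // ltW.
by rewrite /D le_eqVlt; apply/orP; left; apply/eqP; field; rewrite gt_eqF.
Unshelve. all: by end_near. Qed.

Lemma prob_block_cvg_ext (s : nat -> R) (X Y : nat -> nat -> T -> R) (f : R) :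
  (forall n k w, (1 <= n)%N -> X n k w = Y n k w) ->
  prob_block_cvg P h s Y f -> prob_block_cvg P h s X f.
Proof.
move=> XY HY e e0; apply: cvg_trans (HY e e0); apply: near_eq_cvg.
near=> n; congr (P _).
have n1 : (1 <= n)%N by near: n; exact: nbhs_infty_ge.
apply: eq_set => w; congr (is_true (_ < `|_ - 0|)).
by apply: eq_bigr => k _; rewrite XY.
Unshelve. all: by end_near. Qed.

End Concentration.

Theorem proposition2p2 (d : measure_display) (T : measurableType d)
  (R : realType) (P : probability T R) (h : nat -> R)
  (S : nat -> 'I_2 -> nat -> {RV P >-> R})
  (M : nat -> 'I_2 -> {RV P >-> nat})
  (h_gt0 : forall n, (1 <= n)%N -> 0 < h n)
  (h_cvg0 : h @ \oo --> (0 : R))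
  (nh_cvgy : (fun n => n%:R * h n) @ \oo --> +oo)
  (nh2_cvg0 : (fun n => n%:R * h n ^+ 2) @ \oo --> (0 : R))
  (S_times : sampling_times h S M)
  (hB1 : forall q : R, 0 < q -> B1 P h S M q)
  (hB2 : forall q : R, 0 < q -> B2 P h S M q)
  (hmix : forall q : R, 0 < q -> mixing_summable P h S M q)
  (hmean : exists f11 f12 f22 : nat -> R,
     (forall p, [/\ 0 <= f11 p, 0 <= f12 p & 0 <= f22 p]) /\
     forall (p : nat) (s : nat -> R), partitions s ->
       [/\ mean_block_cvg P h s (X11 S M s p) (f11 p),
           mean_block_cvg P h s (X12 S M s p) (f12 p) &
           mean_block_cvg P h s (X22 S M s p) (f22 p)]) :
  forall p : nat, exists f11 f12 f22 : R,
    [/\ 0 <= f11, 0 <= f12 & 0 <= f22] /\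
    forall s : nat -> R, partitions s ->
      [/\ prob_block_cvg P h s (X11 S M s p) f11,
          prob_block_cvg P h s (X12 S M s p) f12 &
          prob_block_cvg P h s (X22 S M s p) f22].
Proof.
move=> p; exists 1, 1, 1; split=> // s ps.
have gS n w : (1 <= n)%N ->
    forall l, grid (n%:R * h n) (fun i => S n l i w) (M n l w).
  by move=> n1 l; exact: grid_sampling_times S_times n l w n1.
have cvgX l :=
  block_cvg P h S M h_gt0 S_times h_cvg0 nh2_cvg0 (hB2 1 ltr01) l s ps.
split.
- apply: prob_block_cvg_ext (cvgX comp1) => n k w n1.
  exact: form11E (gS n w n1) s p k.
- apply: prob_block_cvg_ext (cvgX comp1) => n k w n1.
  exact: form12E (gS n w n1) s p k.
- apply: prob_block_cvg_ext (cvgX comp2) => n k w n1.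
  exact: form22E (gS n w n1) s p k.
Qed.
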